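(* For primes $p\geq 5$ and integers $c$, the average value of the fixed point-counting function $M_c(p)$ exists and is equal to $1$ or $2$ or $0$ as $c\to\infty$. Specifically: (a) $\displaystyle \lim_{c\to\infty}\frac{\sum_{5\leq p\leq c-1,\ p\mid (c-1)}M_c(p)}{\sum_{5\leq p\leq c-1,\ p\mid (c-1)}1}=1$; (b) $\displaystyle \lim_{c\to\infty}\frac{\sum_{5\leq p\leq c,\ p\mid c}M_c(p)}{\sum_{5\leq p\leq c,\ p\mid c}1}=2$; (c) $\displaystyle \lim_{c\to\infty}\frac{\sum_{5\leq p\leq c+1,\ p\mid (c+1)}M_c(p)}{\sum_{5\leq p\leq c+1,\ p\mid (c+1)}1}=0$.
   Context: For an integer $c$ and a prime $p\geq 5$, $\varphi_{p-1,c}(z)=z^{p-1}+c$ and $M_c(p)=\#\{z\in\mathbb{Z}/p\mathbb{Z} : \varphi_{p-1,c}(z)-z\equiv 0\pmod p\}$. In each sum $c$ is a fixed integer and $p$ ranges over primes satisfying the indicated conditions. *)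

(* Defs.v *)
From HB Require Import structures.
From mathcomp Require Import all_boot all_order all_algebra.
From mathcomp Require Import all_classical all_reals topology normedtype.
Set Implicit Arguments.
Unset Strict Implicit.
Unset Printing Implicit Defensive.
Import Order.TTheory GRing.Theory Num.Theory.
Import numFieldNormedType.Exports.
Local Open Scope classical_set_scope.
Local Open Scope ring_scope.

Definition phi (A : pzRingType) (d : nat) (c : int) (z : A) : A :=
  z ^+ d + c%:~R.

(* 'Z_p is the ring Z/pZ only for p > 1; below, p is always a prime >= 5. *)
Definition fixpt_count (c : int) (p : nat) : nat :=
  #|[pred z : 'Z_p | phi p.-1 c z - z == 0]|.

(* The sum of F p over the primes p with 5 <= p <= n and p | n. For n >= 0 the
   upper bound of the range already says p <= n; for n < 0 the sum is empty. *)
Definition prime_divisor_sum (R : pzRingType) (n : int) (F : nat -> R) : R :=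
  \sum_(5 <= p < `|n|%N.+1 | [&& prime p, p%:Z <= n & (p%:Z %| n)%Z]) F p.

Definition int_pinfty : set_system int :=
  filter_from setT (fun N : int => [set c | N <= c]).

Global Instance int_pinfty_filter : ProperFilter int_pinfty.
Proof.
apply: filter_from_proper; last by move=> N _; exists N => /=.
apply: filter_from_filter; first by exists 0.
move=> N N' _ _; exists (Num.max N N') => // c /=.
by rewrite ge_max => /andP[].
Qed.

(* num c / den c --> l as c --> +oo. The quotient is meaningless where
   den c = 0 (in MathComp it would be 0), which happens for arbitrarily large c
   when den counts the prime divisors p >= 5 of c (take c a power of 2). So the
   limit is taken along the c with den c != 0; the first clause says that there
   are arbitrarily large such c, without which the second would be vacuous. *)
Definition quotient_limit (R : realType) (num den : int -> R) (l : R) : Prop :=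
  let F := within [set c | den c != 0] int_pinfty in
  ProperFilter F /\ num c / den c @[c --> F] --> l.

(* Main.v *)
Require Import Defs.
From mathcomp Require Import all_boot all_order all_algebra.
From mathcomp Require Import all_classical all_reals topology normedtype.
From mathcomp Require Import finfield.
Import Order.TTheory GRing.Theory Num.Theory.
Import numFieldNormedType.Exports.
Local Open Scope ring_scope.

(** By Fermat's little theorem z ^+ p.-1 is 1 when z != 0 and 0 when z = 0, so
    modulo p the fixed points of z ^+ p.-1 + c solve [z != 0] + c = z.  When c
    is 1, 0 or -1 modulo p the solutions are respectively {2}, {0, 1} and none
    ([card_fixpt_1], [card_fixpt_0], [card_fixpt_N1]); the first case uses
    p >= 5 to know that 2 is nonzero.  In each of the three sums p divides n,
    where n is c - 1, c or c + 1, which imposes one of these residues on c;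
    hence M_c(p) has the same value l for all the summands, the quotient of the
    sums is equal to l wherever its denominator is nonzero, and the limit is
    that of a constant ([quotient_limit_cst]).  The denominator is nonzero for
    arbitrarily large c because n can be taken to be a large multiple of 5. *)

(** Fermat's little theorem in a form that includes z = 0. *)
Lemma Fp_exp_pred (p : nat) (p_pr : prime p) (z : 'F_p) :
  z ^+ p.-1 = (z != 0)%:R.
Proof.
have [->|z_neq0] := eqVneq z 0; last first.
  apply: (mulfI z_neq0); rewrite mulr1 -exprS prednK ?prime_gt0 //.
  by have := expf_card z; rewrite card_Fp.
by rewrite expr0n -subn1 subn_eq0 leqNgt prime_gt1.
Qed.

(** For a prime p, 'Z_p and the field 'F_p are equal, but only up to the
    propositional equality pdiv p = p. *)
Lemma fixpt_countE (c : int) (p : nat) (p_pr : prime p) :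
  fixpt_count c p = #|[pred z : 'F_p | (z != 0)%:R + c%:~R == z]|.
Proof.
have -> : fixpt_count c p = fixpt_count c (pdiv p) by rewrite pdiv_id.
apply: eq_card => z; rewrite !inE /phi subr_eq0 -(Fp_exp_pred _ p_pr).
by congr (_ ^+ _.-1 + _ == _); rewrite pdiv_id.
Qed.

Lemma Fp_intr_eq (p : nat) (p_pr : prime p) (c d : int) :
  (p%:Z %| c - d)%Z -> c%:~R = d%:~R :> 'F_p.
Proof.
case/dvdzP=> q /eqP; rewrite subr_eq => /eqP ->.
by rewrite intrD intrM -pmulrn (pcharf0 (pchar_Fp p_pr)) mulr0 add0r.
Qed.

Lemma card_fixpt_1 (c : int) (p : nat) :
  (5 <= p)%N -> prime p -> (p%:Z %| c - 1)%Z -> fixpt_count c p = 1%N.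
Proof.
move=> p_ge5 p_pr /(Fp_intr_eq _ p_pr) c1; rewrite fixpt_countE // c1.
have two_neq0 : 2 != 0 :> 'F_p.
  by rewrite -(dvdn_pcharf (pchar_Fp p_pr)) gtnNdvd // (leq_trans _ p_ge5).
rewrite -(card1 (2 : 'F_p)); apply: eq_card => z; rewrite !inE.
have [->|_] := eqVneq z 0; last by rewrite eq_sym.
by rewrite add0r oner_eq0 eq_sym (negbTE two_neq0).
Qed.

Lemma card_fixpt_0 (c : int) (p : nat) :
  prime p -> (p%:Z %| c)%Z -> fixpt_count c p = 2.
Proof.
rewrite -[X in (_ %| X)%Z]subr0 => p_pr /(Fp_intr_eq _ p_pr) c0.
rewrite fixpt_countE // c0.
have -> : 2 = #|pred2 (0 : 'F_p) 1| by rewrite card2 eq_sym oner_eq0.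
apply: eq_card => z; rewrite !inE addr0.
by have [->|_] := eqVneq z 0; rewrite ?eqxx // eq_sym.
Qed.

Lemma card_fixpt_N1 (c : int) (p : nat) :
  prime p -> (p%:Z %| c + 1)%Z -> fixpt_count c p = 0%N.
Proof.
rewrite -[X in c + X]opprK => p_pr /(Fp_intr_eq _ p_pr) cN1.
rewrite fixpt_countE // cN1; apply: eq_card0 => z; rewrite !inE.
have [->|z_neq0] := eqVneq z 0; first by rewrite add0r oppr_eq0 oner_eq0.
by rewrite subrr eq_sym (negbTE z_neq0).
Qed.

(** The prime 5 contributes a positive term to the sum. *)
Lemma prime_divisor_sum_neq0 (R : realType) (n : int) :
  0 < n -> (5 %| n)%Z -> prime_divisor_sum n (fun=> 1 : R) != 0.
Proof.
case: n => // n n_gt0 dvd5n; have le5n : (5 <= n)%N by apply: dvdn_leq.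
rewrite /prime_divisor_sum big_mkcond (bigD1_seq 5%N) /= ?iota_uniq //; last first.
  by rewrite mem_index_iota.
rewrite dvd5n lez_nat le5n /= lt0r_neq0 // ltr_pwDl ?ltr01 //.
by apply: sumr_ge0 => p _; case: ifP.
Qed.

(** The limit is taken along the filter of large c with a nonzero denominator:
    to be proper it needs such c to be arbitrarily large, which the first
    hypothesis provides. *)
Lemma quotient_limit_cst (R : realType) (n : int -> int) (l : nat) :
  (forall N : int, exists2 c, N <= c & 0 < n c /\ (5 %| n c)%Z) ->
  (forall c p, (5 <= p)%N -> prime p -> (p%:Z %| n c)%Z -> fixpt_count c p = l) ->
  quotient_limit
    (fun c => prime_divisor_sum (n c) (fun p => (fixpt_count c p)%:R : R))
    (fun c => prime_divisor_sum (n c) (fun=> 1 : R)) l%:R.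
Proof.
move=> n_large count_l; split.
  apply: Build_ProperFilter_ex => A [N _ subA].
  have [c leNc [n_gt0 dvd5]] := n_large N.
  by exists c; apply: subA => //=; apply: prime_divisor_sum_neq0.
apply: cvg_near_cst; rewrite near_withinE; exists 0 => // c _ /= den_neq0.
rewrite -[RHS](mulfK den_neq0); congr (_ / _).
rewrite /prime_divisor_sum mulr_sumr big_nat_cond [RHS]big_nat_cond.
apply: eq_bigr => p /andP[/andP[p_ge5 _] /and3P[p_pr _ p_dvd]].
by rewrite count_l // mulr1.
Qed.

(** Witnesses for the hypothesis of [quotient_limit_cst] when n is a shift. *)
Lemma shift_large (e N : int) :
  exists2 c, N <= c & 0 < c + e /\ (5 %| c + e)%Z.
Proof.
exists (5 * (`|N + e| + 1) - e); last first.
  by rewrite subrK dvdz_mulr // mulr_gt0 // ltr_wpDl.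
rewrite lerBrDr (le_trans (ler_norm _)) //.
apply: (@le_trans _ _ (`|N + e| + 1)); first by rewrite lerDl.
by rewrite ler_peMl // addr_ge0.
Qed.

Theorem corollary4p3 (R : realType) :
  [/\ quotient_limit
        (fun c : int => prime_divisor_sum (c - 1) (fun p => (fixpt_count c p)%:R : R))
        (fun c : int => prime_divisor_sum (c - 1) (fun _ => 1 : R))
        1,
      quotient_limit
        (fun c : int => prime_divisor_sum c (fun p => (fixpt_count c p)%:R : R))
        (fun c : int => prime_divisor_sum c (fun _ => 1 : R))
        2
    & quotient_limit
        (fun c : int => prime_divisor_sum (c + 1) (fun p => (fixpt_count c p)%:R : R))
        (fun c : int => prime_divisor_sum (c + 1) (fun _ => 1 : R))
        0].
Proof.
split.
- apply: (quotient_limit_cst R (fun c => c - 1) 1) => [N|c p]; first exact: shift_large.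
  exact: card_fixpt_1.
- apply: (quotient_limit_cst R id 2) => [N|c p _]; last exact: card_fixpt_0.
  by have [c] := shift_large 0 N; rewrite addr0; exists c.
- apply: (quotient_limit_cst R (fun c => c + 1) 0) => [N|c p _]; first exact: shift_large.
  exact: card_fixpt_N1.
Qed.
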